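(* There is an absolute constant $C>0$ such that for every $n\in\mathbb N$ and any positive numbers $\alpha_1,\dots,\alpha_n$ there exist points $z_1,\dots,z_n\in\mathbb T$ with $$\int_{\mathbb D}\left|\sum_{k=1}^n\frac{\alpha_k}{z-z_k}\right|dm(z)\ \le\ C\,\frac{\sum_{k=1}^n\alpha_k^2}{\sum_{k=1}^n\alpha_k}.$$
   Context: $\mathbb D$ is the open unit disc in $\mathbb C$, $\mathbb T$ the unit circle, and $m$ planar Lebesgue measure. *)

(* Defs.v *)
From HB Require Import structures.
From mathcomp Require Import all_boot all_order all_algebra.
From mathcomp Require Import all_classical all_reals all_analysis.
From mathcomp Require Import complex.
Set Implicit Arguments. Unset Strict Implicit. Unset Printing Implicit Defensive.
Import Order.TTheory GRing.Theory Num.Theory.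
Local Open Scope ring_scope.
Local Open Scope classical_set_scope.

(* The complex plane C is identified with R * R via (x, y) |-> x + i y.
   Planar Lebesgue measure m is the product Lebesgue measure on R * R. *)
Definition cplx (R : realType) (p : R * R) : R[i] := (p.1 +i* p.2)%C.

Definition planar_lebesgue (R : realType) :=
  ((@lebesgue_measure R) \x (@lebesgue_measure R))%E.

Definition unit_disc (R : realType) : set (R * R) :=
  [set p | p.1 ^+ 2 + p.2 ^+ 2 < 1].

Definition on_unit_circle (R : realType) (z : R[i]) : Prop := Normc.normc z = 1.

(* Main.v *)
(** Let [A] be the sum of the weights. Cut the circle into consecutive arcs of
    lengths [l_k = 2 pi alpha_k / A] and let [z_k] be the midpoint of the [k]-th
    arc. The uniform measure of mass [A] on the circle has vanishing Cauchy
    transform in the disc, so the sum equals a sum over [k] of differences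
    between a point mass [alpha_k] at [z_k] and the same mass spread over the arc.
    Each difference is of size [alpha_k / |z - z_k|] near the arc and, by the
    midpoint rule, of size [alpha_k l_k^2 / |z - z_k|^3] away from it; both are
    controlled by [alpha_k] times the kernel [l^2 / (rho (rho^2 + l^2))], whose
    planar integral is [O(l)]. Summing gives [O(sum alpha_k l_k)].

    The Cauchy transform of the arc is handled through an explicit primitive of
    [z / (z - e^(it))], namely [i log (1 - z e^(-it))], whose real and imaginary
    parts are a logarithm and an arctangent. *)
Require Import Defs.
From HB Require Import structures.
From mathcomp Require Import all_boot all_order all_algebra.
From mathcomp Require Import all_classical all_reals all_analysis.
From mathcomp Require Import complex measurable_realfun ring lra.
Import Order.TTheory GRing.Theory Num.Theory.
Import numFieldNormedType.Exports.
Local Open Scope ring_scope.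
Local Open Scope classical_set_scope.

(** * Integrals of the dominating kernel *)

Section kernel_integral.
Variable R : realType.
Notation mu := (@lebesgue_measure R).
Implicit Types a b l x y : R.

(** One coordinate's share of the planar kernel at scale [l]: an integrable singularity [|x|^(-1/2)]
    at 0 and decay [l |x|^(-3/2)] at infinity. *)
Definition sqrt_kernel (l x : R) : R := l / (Num.sqrt `|x| * (l + `|x|)).

Lemma sqrt_kernel_ge0 l x : 0 < l -> 0 <= sqrt_kernel l x.
Proof.
by move=> l0; rewrite divr_ge0 ?mulr_ge0 ?addr_ge0 ?sqrtr_ge0 // ltW.
Qed.

Lemma sqrt_kernelN l x : sqrt_kernel l (- x) = sqrt_kernel l x.
Proof. by rewrite /sqrt_kernel normrN. Qed.

Lemma continuous_sqrt_kernel l x : 0 < l -> x != 0 ->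
  {for x, continuous (sqrt_kernel l)}.
Proof.
move=> l0 x0; apply: cvgM; first exact: cvg_cst.
apply: cvgV.
  by rewrite mulf_neq0// ?gt_eqF ?sqrtr_gt0 ?normr_gt0// ltr_wpDr.
apply: cvgM.
  by apply: continuous_comp; [exact: norm_continuous | exact: sqrt_continuous].
by apply: cvgD; [exact: cvg_cst | exact: norm_continuous].
Qed.

Lemma continuous_sqrt_kernelB l a x : 0 < l -> x != a ->
  {for x, continuous (fun x => sqrt_kernel l (x - a))}.
Proof.
move=> l0 xa.
apply: (@continuous_comp _ _ _ (fun x => x - a) (sqrt_kernel l)).
  by apply: cvgB; [exact: cvg_id | exact: cvg_cst].
by apply: continuous_sqrt_kernel; rewrite // subr_eq0.
Qed.

(** Inversion is continuous only off 0, where its default value is 0, so [[set 0]] and its open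
    complement are treated separately. *)
Lemma measurable_inv : measurable_fun [set: R] (@GRing.inv R).
Proof.
have -> : [set: R] = [set 0] `|` [set x | x != 0].
  by rewrite eqEsubset; split=> // x _ /=; case: (eqVneq x 0); [left|right].
have mN : measurable [set x : R | x != 0] by apply: open_measurable;
  exact: open_neq.
apply/measurable_funU => //; split; first exact: measurable_fun_set1.
apply: open_continuous_measurable_fun; first exact: open_neq.
by move=> x; rewrite inE/=; exact: inv_continuous.
Qed.

Lemma measurable_funV d (T : measurableType d) (D : set T) (f : T -> R) :
  measurable_fun D f -> measurable_fun D (fun t => (f t)^-1).
Proof. exact: measurableT_comp measurable_inv. Qed.

Lemma measurable_fun_sqrt d (T : measurableType d) (D : set T) (f : T -> R) :
  measurable_fun D f -> measurable_fun D (fun t => Num.sqrt (f t)).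
Proof.
by apply: measurableT_comp; apply: continuous_measurable_fun;
  exact: sqrt_continuous.
Qed.

Lemma measurable_sqrt_kernel l : measurable_fun [set: R] (sqrt_kernel l).
Proof.
have mn : measurable_fun [set: R] (fun x : R => `|x|) by exact: normr_measurable.
apply: measurable_funM => //; apply: measurable_funV.
apply: measurable_funM; first exact: measurable_fun_sqrt.
by apply: measurable_funD.
Qed.

(** The substitution [u = sqrt ((x - a) / l)] turns the kernel into [2 sqrt l / (1 + u^2)]. *)
Lemma is_derive_sqrt_kernel_prim l a x : 0 < l -> a < x ->
  is_derive x 1 (fun x => 2 * Num.sqrt l * atan (Num.sqrt (x - a) / Num.sqrt l))
    (sqrt_kernel l (x - a)).
Proof.
move=> l0 ax.
have sl0 : 0 < Num.sqrt l by rewrite sqrtr_gt0.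
have xa : 0 < x - a by rewrite subr_gt0.
have sx0 : 0 < Num.sqrt (x - a) by rewrite sqrtr_gt0.
have d1 : is_derive x 1 (fun x : R => x - a) 1.
  by apply: is_derive_eq; rewrite subr0.
have d2 : is_derive x 1 (fun x : R => Num.sqrt (x - a))
   ((2 * Num.sqrt (x - a))^-1).
  have := @is_derive1_comp R _ (fun x => x - a) x _ 1 (is_derive1_sqrt xa) d1.
  by rewrite mulr1.
have d3 : is_derive x 1 (fun x : R => Num.sqrt (x - a) / Num.sqrt l)
   ((2 * Num.sqrt (x - a))^-1 / Num.sqrt l).
  by apply: is_derive_eq; rewrite scaler0 add0r /GRing.scale/= mulrC.
have d4 := @is_derive1_comp R _ (fun x => Num.sqrt (x - a) / Num.sqrt l) x _ _
  (is_derive1_atan _) d3.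
have d5 := is_deriveZ (2 * Num.sqrt l) d4.
apply: is_derive_eq; rewrite /GRing.scale/=.
rewrite /sqrt_kernel gtr0_norm// expr_div_n !sqr_sqrtr ?(ltW xa) ?(ltW l0)//.
by field; rewrite !gt_eqF//= addr_gt0.
Qed.

Lemma integral_sqrt_kernel_bndy l a b : 0 < l -> a < b ->
  (\int[mu]_(x in `[b, +oo[) (sqrt_kernel l (x - a))%:E
     <= (pi * Num.sqrt l)%:E)%E.
Proof.
move=> l0 ab.
have sl0 : 0 < Num.sqrt l by rewrite sqrtr_gt0.
pose F x := 2 * Num.sqrt l * atan (Num.sqrt (x - a) / Num.sqrt l).
rewrite (@ge0_continuous_FTC2y _ _ F b (2 * Num.sqrt l * (pi / 2))).
(* The integral equals [pi * sqrt l - F b], and [F b] is nonnegative. *)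
- rewrite -EFinB lee_fin lerBlDr (_ : 2 * _ * (pi / 2) = pi * Num.sqrt l).
    rewrite lerDl /F; apply: mulr_ge0; first by rewrite mulr_ge0// ltW.
    by rewrite -atan0; apply: (le_atan); rewrite divr_ge0// sqrtr_ge0.
  by field.
- by move=> x _; exact: sqrt_kernel_ge0.
- apply: continuous_in_subspaceT => x; rewrite inE/= in_itv/= andbT => bx.
  by apply: continuous_sqrt_kernelB; rewrite // gt_eqF// (lt_le_trans ab).
- apply: cvgMr.
  have : Num.sqrt (x - a) / Num.sqrt l @[x --> +oo] --> +oo.
    apply/cvgryPge => M; near=> x.
    rewrite ler_pdivlMr//.
    have [M0|M0] := leP M 0.
      by rewrite (le_trans (mulr_le0_ge0 M0 (ltW sl0)))// sqrtr_ge0.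
    rewrite -(ger0_norm (ltW M0)) -sqrtr_sqr -sqrtrM ?sqr_ge0//.
    rewrite ler_wsqrtr// lerBrDr.
    by near: x; apply: nbhs_pinfty_ge; rewrite num_real.
  by move=> /cvg_comp; apply; exact: cvgy_atan.
- by move=> x bx; have [] := is_derive_sqrt_kernel_prim l a x l0 (lt_trans ab bx).
- apply: cvg_at_right_filter.
  apply/differentiable_continuous/derivable1_diffP.
  by have [] := is_derive_sqrt_kernel_prim l a b l0 ab.
- move=> x; rewrite in_itv/= andbT => bx; rewrite derive1E.
  by have [_ ->] := is_derive_sqrt_kernel_prim l a x l0 (lt_trans ab bx).
Unshelve. all: by end_near. Qed.

Lemma integral_sqrt_kernel_Nybnd l a b : 0 < l -> b < a ->
  (\int[mu]_(x in `]-oo, b]) (sqrt_kernel l (x - a))%:E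
     <= (pi * Num.sqrt l)%:E)%E.
Proof.
move=> l0 ba; rewrite -[b]opprK ge0_integration_by_substitutionNy.
- under eq_integral => x _ do rewrite /= -opprD -[a in x + a]opprK sqrt_kernelN.
  by apply: integral_sqrt_kernel_bndy => //; rewrite ltrN2.
- apply: continuous_in_subspaceT => x; rewrite inE/= in_itv/= opprK => xb.
  by apply: continuous_sqrt_kernelB; rewrite // lt_eqF// (le_lt_trans xb).
- by move=> x _; exact: sqrt_kernel_ge0.
Qed.

(** The fundamental theorem applies only away from the singularity [a]. Pairs of half-lines at
    distance [1/(i+1)] from [a] exhaust the line up to a null point, and monotone convergence passes
    their uniform bound to the limit. *)
Lemma integral_sqrt_kernel l a : 0 < l ->
  (\int[mu]_x (sqrt_kernel l (x - a))%:E <= (2 * pi * Num.sqrt l)%:E)%E.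
Proof.
move=> l0.
have mk : measurable_fun [set: R] (fun x => (sqrt_kernel l (x - a))%:E).
  apply/measurable_EFinP.
  apply: (measurableT_comp (measurable_sqrt_kernel l)).
  exact: measurable_funB.
have k0 x : (0 <= (sqrt_kernel l (x - a))%:E)%E.
  by rewrite lee_fin sqrt_kernel_ge0.
have invS_gt0 i : 0 < i.+1%:R^-1 :> R by rewrite invr_gt0 ltr0n.
pose F i := `]-oo, a - i.+1%:R^-1]%classic `|` `[a + i.+1%:R^-1, +oo[%classic.
have mF i : measurable (F i) by exact: measurableU.
have cover : [set: R] `\` [set a] = \bigcup_i F i.
  apply/seteqP; split=> [x [_ /= /eqP xa]|x [i _ Fx]]; last first.
    split=> // xa; move: Fx; rewrite xa => -[] /=; rewrite in_itv/=.
      by rewrite leNgt ltrBlDr ltrDl invS_gt0.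
    by rewrite andbT leNgt ltrDl invS_gt0.
  have d0 : 0 < `|x - a| by rewrite normr_gt0 subr_eq0.
  have [i ni] := ltr_add_invr d0; rewrite add0r in ni.
  exists i => //; rewrite /F /= !in_itv/= andbT.
  have [xa'|xa'] := leP a x.
    by right; rewrite -lerBrDl ltW//; rewrite ger0_norm ?subr_ge0// in ni.
  left; rewrite ltr0_norm ?subr_lt0// opprB in ni.
  by rewrite lerBrDr -lerBrDl ltW.
rewrite (@ge0_negligible_integral _ _ _ mu _ [set a])//;
  last exact: lebesgue_measure_set1.
rewrite cover.
have ndF : nondecreasing_seq F.
  move=> i j ij; apply/subsetPset => x; rewrite /F /= !in_itv/= !andbT.
  have ji : j.+1%:R^-1 <= i.+1%:R^-1 :> R by rewrite lef_pV2 ?posrE ?ltr0n// ler_nat.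
  by case=> h; [left; rewrite (le_trans h)// lerB
               |right; rewrite (le_trans _ h)// lerD].
have cvgF : (\int[mu]_(x in F i) (sqrt_kernel l (x - a))%:E)%E @[i --> \oo] -->
    (\int[mu]_(x in \bigcup_i F i) (sqrt_kernel l (x - a))%:E)%E.
  by apply: ge0_nondecreasing_set_cvg_integral => // i; exact: measurable_funTS.
rewrite -(cvg_lim _ cvgF)//; apply: lime_le;
  first by apply/cvg_ex; eexists; exact: cvgF.
apply: nearW => i.
rewrite ge0_integral_setU//=.
- rewrite (_ : 2 * pi * _ = pi * Num.sqrt l + pi * Num.sqrt l); last by ring.
  rewrite EFinD; apply: leeD.
    by apply: integral_sqrt_kernel_Nybnd => //; rewrite ltrBlDr ltrDl.
  by apply: integral_sqrt_kernel_bndy => //; rewrite ltrDl.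
- exact: measurable_funTS.
- apply/disj_setPS => x [] /=; rewrite !in_itv/= andbT => h1 h2.
  have := le_trans h2 h1.
  by rewrite leNgt (lt_trans (_ : _ < a))// ?ltrDl ?ltrBlDr ?ltrDl.
Qed.

(** With [rho] the modulus of [p], this is comparable to [1/rho] for [rho <= l] and to [l^2/rho^3]
    for [rho >= l]. *)
Definition planar_kernel (l : R) (p : R * R) : R :=
  l ^+ 2 / (Num.sqrt (p.1 ^+ 2 + p.2 ^+ 2) * (p.1 ^+ 2 + p.2 ^+ 2 + l ^+ 2)).

Lemma planar_kernel_ge0 l p : 0 <= planar_kernel l p.
Proof.
by rewrite divr_ge0 ?sqr_ge0// mulr_ge0 ?sqrtr_ge0// !addr_ge0 ?sqr_ge0.
Qed.

Lemma measurable_planar_kernel l (a : R * R) :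
  measurable_fun [set: R * R] (fun p => planar_kernel l (p - a)).
Proof.
have m1 : measurable_fun [set: R * R] (fun p : R * R => (p.1 - a.1) ^+ 2).
  by apply: measurable_funX; apply: measurable_funB.
have m2 : measurable_fun [set: R * R] (fun p : R * R => (p.2 - a.2) ^+ 2).
  by apply: measurable_funX; apply: measurable_funB.
apply: measurable_funM => //; apply: measurable_funV; apply: measurable_funM.
  by apply: measurable_fun_sqrt; exact: measurable_funD.
by apply: measurable_funD => //; exact: measurable_funD.
Qed.

(* [sqrt (|x| |y|) <= rho] splits the singularity between the two coordinates,
   leaving an integrable product. *)
Lemma planar_kernel_le l p : 0 < l -> p.1 != 0 -> p.2 != 0 ->
  planar_kernel l p <= 2 * (sqrt_kernel l p.1 * sqrt_kernel l p.2).
Proof.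
case: p => x y /= l0 x0 y0; rewrite /planar_kernel /sqrt_kernel /=.
have X0 : 0 < `|x| by rewrite normr_gt0.
have Y0 : 0 < `|y| by rewrite normr_gt0.
rewrite -(real_normK (num_real x)) -(real_normK (num_real y)).
move: `|x| `|y| X0 Y0 => X Y X0 Y0.
have sX : 0 < Num.sqrt X by rewrite sqrtr_gt0.
have sY : 0 < Num.sqrt Y by rewrite sqrtr_gt0.
have sXY : Num.sqrt X * Num.sqrt Y <= Num.sqrt (X ^+ 2 + Y ^+ 2).
  rewrite -sqrtrM ?(ltW X0)// ler_wsqrtr//.
  by have := sqr_ge0 (X - Y); have := mulr_gt0 X0 Y0; rewrite sqrrB; lra.
have q0 : 0 < X ^+ 2 + Y ^+ 2 by rewrite addr_gt0 ?exprn_gt0.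
have s0 : 0 < Num.sqrt (X ^+ 2 + Y ^+ 2) by rewrite sqrtr_gt0.
have h : (l + X) * (l + Y) <= 2 * (X ^+ 2 + Y ^+ 2 + l ^+ 2).
  have := sqr_ge0 (X - Y); have := sqr_ge0 (l - X); have := sqr_ge0 (l - Y).
  have := sqr_ge0 X; have := sqr_ge0 Y.
  rewrite !sqrrB mulrDl !mulrDr; lra.
rewrite ler_pdivrMr; last by rewrite mulr_gt0// addr_gt0// exprn_gt0.
have d0 : 0 < Num.sqrt X * Num.sqrt Y * ((l + X) * (l + Y)).
  by rewrite !mulr_gt0// addr_gt0.
rewrite (_ : 2 * _ * _ = l ^+ 2 *
  (Num.sqrt (X ^+ 2 + Y ^+ 2) * (2 * (X ^+ 2 + Y ^+ 2 + l ^+ 2))) /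
  (Num.sqrt X * Num.sqrt Y * ((l + X) * (l + Y)))); last first.
  by field; rewrite !gt_eqF//= addr_gt0.
rewrite ler_pdivlMr//; apply: ler_wpM2l; first exact: sqr_ge0.
by apply: ler_pM => //; rewrite mulr_ge0 ?addr_ge0 ?(ltW l0) ?ltW.
Qed.

Lemma measurable_sqrt_kernelB l a :
  measurable_fun [set: R] (fun x => sqrt_kernel l (x - a)).
Proof.
apply: (measurableT_comp (measurable_sqrt_kernel l)).
exact: measurable_funB.
Qed.

Lemma integral_planar_kernel l (a : R * R) : 0 < l ->
  (\int[@planar_lebesgue R]_p (planar_kernel l (p - a))%:E
     <= (8 * pi ^+ 2 * l)%:E)%E.
Proof.
move=> l0.
pose f p := sqrt_kernel l (p.1 - a.1) * sqrt_kernel l (p.2 - a.2).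
have f0 p : 0 <= f p by rewrite mulr_ge0 ?sqrt_kernel_ge0.
have mf : measurable_fun [set: R * R] (EFin \o f).
  apply/measurable_EFinP; apply: measurable_funM.
    exact: (measurableT_comp (measurable_sqrt_kernelB l a.1)).
  exact: (measurableT_comp (measurable_sqrt_kernelB l a.2)).
apply: (@le_trans _ _ (\int[@planar_lebesgue R]_p (2%:E * (EFin \o f) p))%E).
  apply: ae_ge0_le_integral => //.
  - by move=> p _; rewrite lee_fin planar_kernel_ge0.
  - by apply/measurable_EFinP; exact: measurable_planar_kernel.
  - by move=> p _; rewrite /= lee_fin mulr_ge0.
  - exact: measurable_funeM.
  (* On the coordinate lines through [a] a factor of [f] takes the default value 0 and the
     domination may fail; these lines are null. *)
  exists ([set a.1] `*` setT `|` setT `*` [set a.2]); split.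
  - by apply: measurableU; exact: measurableX.
  - apply/eqP; rewrite eq_le measure_ge0 andbT.
    apply: (le_trans (measureU2 _ _ _)); try exact: measurableX.
    rewrite [X in (X + _ <= _)%E]product_measure1E//.
    rewrite [X in (_ + X <= _)%E]product_measure1E//.
    rewrite [X in (X * _ + _ <= _)%E](lebesgue_measure_set1 a.1).
    rewrite [X in (_ + _ * X <= _)%E](lebesgue_measure_set1 a.2).
    by rewrite mul0e mule0 adde0.
  - move=> p /= /not_implyP[_ H].
    have [p1|p1] := eqVneq p.1 a.1; first by left.
    have [p2|p2] := eqVneq p.2 a.2; first by right.
    exfalso; apply: H; rewrite lee_fin.
    by apply: planar_kernel_le; rewrite //= subr_eq0.
rewrite ge0_integralZl//; last by move=> p _; rewrite lee_fin.
rewrite /planar_lebesgue fubini_tonelli1//=.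
rewrite /fubini_F /f/=.
under eq_integral => x _.
  under eq_integral => y _ do rewrite EFinM.
  rewrite ge0_integralZl//; last 3 first.
  - by apply/measurable_EFinP; exact: measurable_sqrt_kernelB.
  - by move=> y _; rewrite lee_fin sqrt_kernel_ge0.
  - by rewrite lee_fin sqrt_kernel_ge0.
  over.
rewrite ge0_integralZr//; last 3 first.
- by apply/measurable_EFinP; exact: measurable_sqrt_kernelB.
- by move=> y _; rewrite lee_fin sqrt_kernel_ge0.
- by apply: integral_ge0 => y _; rewrite lee_fin sqrt_kernel_ge0.
(* After Tonelli the integral is twice a product of two one-dimensional integrals, each at most
   [2 pi sqrt l]. *)
rewrite (_ : (8 * pi ^+ 2 * l)%:E =
  2%:E * ((2 * pi * Num.sqrt l)%:E * (2 * pi * Num.sqrt l)%:E))%E; last first.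
  rewrite -!EFinM; congr EFin.
  by rewrite -[in LHS](sqr_sqrtr (ltW l0)); ring.
rewrite lee_wpmul2l ?lee_fin// lee_pmul//; try exact: integral_sqrt_kernel.
- by apply: integral_ge0 => y _; rewrite lee_fin sqrt_kernel_ge0.
- by apply: integral_ge0 => y _; rewrite lee_fin sqrt_kernel_ge0.
Qed.

End kernel_integral.

(** * Midpoint rule for the logarithm along an arc *)

Section complex_norm.
Variable R : realType.

Lemma normc_ge0 (z : R[i]) : 0 <= Normc.normc z.
Proof. by case: z => a b; exact: sqrtr_ge0. Qed.

Lemma normc_Re_Im (z : R[i]) :
  Normc.normc z = Num.sqrt (complex.Re z ^+ 2 + complex.Im z ^+ 2).
Proof. by case: z. Qed.

Lemma normr_Re_le (z : R[i]) : `|complex.Re z| <= Normc.normc z.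
Proof. by case: z => a b /=; rewrite -sqrtr_sqr ler_wsqrtr// lerDl sqr_ge0. Qed.

Lemma normr_Im_le (z : R[i]) : `|complex.Im z| <= Normc.normc z.
Proof. by case: z => a b /=; rewrite -sqrtr_sqr ler_wsqrtr// lerDr sqr_ge0. Qed.

Lemma normc_le_ReIm (z : R[i]) :
  Normc.normc z <= `|complex.Re z| + `|complex.Im z|.
Proof.
case: z => a b /=; have h : 0 <= `|a| + `|b| by rewrite addr_ge0.
rewrite -[leRHS]ger0_norm// -sqrtr_sqr ler_wsqrtr// sqrrD !real_normK ?num_real//.
by rewrite addrAC lerDl mulrn_wge0// mulr_ge0.
Qed.

Lemma Re_sum n (u : 'I_n -> R[i]) :
  complex.Re (\sum_(k < n) u k) = \sum_(k < n) complex.Re (u k).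
Proof. by apply: (big_morph (@complex.Re R)) => // -[? ?] [? ?]. Qed.

Lemma Im_sum n (u : 'I_n -> R[i]) :
  complex.Im (\sum_(k < n) u k) = \sum_(k < n) complex.Im (u k).
Proof. by apply: (big_morph (@complex.Im R)) => // -[? ?] [? ?]. Qed.

End complex_norm.

Section midpoint.
Variable R : realType.
Implicit Types h M phi s t x : R.

(** The function [g] vanishes at 0 and its derivative [dg] is the symmetric second difference of
    [df]; the mean value theorem on [[0, h]] concludes. *)
Lemma midpoint_rule_le (f df : R -> R) phi h M : 0 <= h ->
  (forall x, is_derive x 1 f (df x)) ->
  (forall t, 0 <= t <= h ->
     `|df (phi + t) + df (phi - t) - 2 * df phi| <= M) ->
  `|2 * h * df phi - (f (phi + h) - f (phi - h))| <= M * h.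
Proof.
move=> h0 dff hM.
pose g t := f (phi + t) - f (phi - t) - 2 * df phi * t.
pose dg t := df (phi + t) + df (phi - t) - 2 * df phi.
have dgE t : is_derive t 1 g (dg t).
  have d1 : is_derive t 1 (fun t => phi + t) 1.
    by have := is_deriveD (is_derive_cst phi t 1) (is_derive_id t 1); rewrite add0r.
  have d2 : is_derive t 1 (fun t => phi - t) (-1).
    by have := is_deriveB (is_derive_cst phi t 1) (is_derive_id t 1); rewrite add0r.
  have d3 := @is_derive1_comp R f (fun t => phi + t) t _ _ (dff _) d1.
  have d4 := @is_derive1_comp R f (fun t => phi - t) t _ _ (dff _) d2.
  have d5 : is_derive t 1 (fun t => 2 * df phi * t) (2 * df phi).
    by have := is_deriveZ (2 * df phi) (is_derive_id t 1); rewrite /GRing.scale/= mulr1.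
  have := is_deriveB (is_deriveB d3 d4) d5.
  by rewrite /dg mulr1 mulrN1 opprK.
have [|c] := MVT_segment h0 (fun t _ => dgE t).
  by apply: derivable_within_continuous => t _; have [] := dgE t.
rewrite in_itv/= => ch; rewrite subr0 => gE.
have -> : 2 * h * df phi - (f (phi + h) - f (phi - h)) = - (dg c * h).
  by rewrite -gE /g addr0 subr0; ring.
by rewrite normrN normrM (ger0_norm h0) ler_wpM2r// hM.
Qed.

Lemma normr_sin_le s : `|sin s| <= `|s|.
Proof.
wlog s0 : s / 0 <= s.
  move=> H; have [/H//|s0] := leP 0 s.
  by rewrite -normrN -sinN -[leRHS]normrN H// oppr_ge0 ltW.
have [|c _] := @MVT_segment R sin cos 0 s s0 (fun t _ => is_derive_sin t).
  by apply: derivable_within_continuous => t _.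
rewrite sin0 !subr0 => ->; rewrite normrM ler_piMl//.
by rewrite ler_norml cos_geN1 cos_le1.
Qed.

Lemma one_sub_cos_le t : 1 - cos t <= t ^+ 2 / 2.
Proof.
have ct : cos t = 1 - 2 * sin (t / 2) ^+ 2.
  rewrite [in LHS](_ : t = (t / 2) *+ 2); last by rewrite mulr2n; field.
  by rewrite cos_mulr2n cos2sin2 mulr2n; ring.
have : sin (t / 2) ^+ 2 <= (t / 2) ^+ 2.
  rewrite -[leLHS](real_normK (num_real _)) -[leRHS](real_normK (num_real _)).
  by rewrite lerXn2r ?nnegrE// normr_sin_le.
by rewrite ct; lra.
Qed.

End midpoint.

(** * The logarithm of [1 - z e^(-it)] and the second differences of its derivative *)

Section arc_functions.
Variable R : realType.
Variables x y : R.
Hypothesis xy1 : x ^+ 2 + y ^+ 2 < 1.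
Implicit Types t phi h l : R.

(* With [z = x + i y], [arc_re t + i arc_im t = 1 - z e^(-it)], whose modulus is
   [|z - e^(it)|]; [arc_ln] and [arc_arg] are the real and imaginary parts of its
   principal logarithm, as [arc_re > 0] in the disc. *)
Definition arc_re t := 1 - x * cos t - y * sin t.
Definition arc_im t := x * sin t - y * cos t.
Definition arc_sq t := arc_re t ^+ 2 + arc_im t ^+ 2.
Definition arc_ln t := ln (arc_sq t) / 2.
Definition arc_arg t := atan (arc_im t / arc_re t).

Lemma arc_sqE t : arc_sq t = (x - cos t) ^+ 2 + (y - sin t) ^+ 2.
Proof.
transitivity (1 - 2 * (x * cos t + y * sin t)
    + (x ^+ 2 + y ^+ 2) * (cos t ^+ 2 + sin t ^+ 2)).
  by rewrite /arc_sq /arc_re /arc_im; ring.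
rewrite cos2Dsin2.
by have := cos2Dsin2 t; lra.
Qed.

(** [(1 - arc_re t) - i arc_im t] is the rotated point [z e^(-it)], of the same modulus as [z]. *)
Lemma arc_normE t : (1 - arc_re t) ^+ 2 + arc_im t ^+ 2 = x ^+ 2 + y ^+ 2.
Proof.
transitivity ((x ^+ 2 + y ^+ 2) * (cos t ^+ 2 + sin t ^+ 2)).
  by rewrite /arc_re /arc_im; ring.
by rewrite cos2Dsin2 mulr1.
Qed.

Lemma arc_norm_lt1 t : (1 - arc_re t) ^+ 2 + arc_im t ^+ 2 < 1.
Proof. by rewrite arc_normE. Qed.

(** The point [arc_re + i arc_im] lies in the open unit disc centred at 1, hence in the right
    half-plane. *)
Lemma arc_re_gt0 t : 0 < arc_re t.
Proof. by have := arc_norm_lt1 t; have := sqr_ge0 (arc_im t); nra. Qed.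

Lemma arc_sq_gt0 t : 0 < arc_sq t.
Proof. by rewrite /arc_sq ltr_pwDl ?sqr_ge0// exprn_gt0// arc_re_gt0. Qed.

Lemma arc_sq_lt t : arc_sq t < 2 * arc_re t.
Proof. by have := arc_norm_lt1 t; rewrite /arc_sq; lra. Qed.

Lemma is_derive_arc_re t : is_derive t 1 arc_re (arc_im t).
Proof.
have := is_deriveB (is_deriveB (is_derive_cst (1 : R) t 1)
  (is_deriveZ x (is_derive_cos t))) (is_deriveZ y (is_derive_sin t)).
by rewrite /GRing.scale/= sub0r mulrN opprK.
Qed.

Lemma is_derive_arc_im t : is_derive t 1 arc_im (1 - arc_re t).
Proof.
have := is_deriveB (is_deriveZ x (is_derive_sin t)) (is_deriveZ y (is_derive_cos t)).
rewrite /GRing.scale/= mulrN opprK => H; apply: is_derive_eq.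
by rewrite /arc_re; ring.
Qed.

(** For [w = 1 - z e^(-it)] one has [w' = i (1 - w)], so [(log w)' = i (1/w - 1)]; this derivative
    and the next are its real and imaginary parts. *)
Lemma is_derive_arc_ln t : is_derive t 1 arc_ln (arc_im t / arc_sq t).
Proof.
have dre := is_derive_arc_re t; have dim := is_derive_arc_im t.
have dsq : is_derive t 1 arc_sq (2 * arc_im t).
  have := is_deriveD (is_deriveX 2 dre) (is_deriveX 2 dim).
  rewrite /GRing.scale/= !expr1 => H; apply: is_derive_eq; ring.
have := is_deriveZ 2^-1 (is_derive1_comp (is_derive1_ln (arc_sq_gt0 t)) dsq).
rewrite (_ : _ \*: _ = arc_ln); last by apply/funext => s /=; rewrite /arc_ln mulrC.
move=> H; apply: is_derive_eq; rewrite /GRing.scale/=.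
by field; rewrite gt_eqF ?arc_sq_gt0.
Qed.

Lemma is_derive_arc_arg t : is_derive t 1 arc_arg (arc_re t / arc_sq t - 1).
Proof.
have dre := is_derive_arc_re t; have dim := is_derive_arc_im t.
have re0 := arc_re_gt0 t.
have dV := is_deriveV (lt0r_neq0 re0) dre.
have := is_derive1_comp (is_derive1_atan _) (is_deriveM dim dV).
move=> H; apply: is_derive_eq; rewrite /GRing.scale/=.
have := arc_sq_gt0 t; rewrite /arc_sq => sq0.
have e : 1 + (arc_im t / arc_re t) ^+ 2 = arc_sq t / arc_re t ^+ 2.
  by rewrite /arc_sq; field; rewrite gt_eqF.
rewrite [_ t](_ : _ = arc_im t / arc_re t)// e /arc_sq.
by field; rewrite !gt_eqF.
Qed.

Definition arc_dist t := Num.sqrt (arc_sq t).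

Definition arc_cplx t : R[i] := (arc_re t +i* arc_im t)%C.

Lemma arc_dist_gt0 t : 0 < arc_dist t.
Proof. by rewrite sqrtr_gt0 arc_sq_gt0. Qed.

Lemma normc_arc_cplx t : Normc.normc (arc_cplx t) = arc_dist t.
Proof. by []. Qed.

Lemma arc_cplx_neq0 t : arc_cplx t != 0.
Proof.
apply/eqP => e; have := arc_dist_gt0 t.
by rewrite -normc_arc_cplx e Normc.normc0 ltxx.
Qed.

Lemma arc_cplxD phi t :
  arc_cplx (phi + t) = 1 - (1 - arc_cplx phi) * (cos t -i* sin t)%C.
Proof.
apply/eqP; rewrite eq_complex /= /arc_re /arc_im cosD sinD.
by apply/andP; split; apply/eqP; ring.
Qed.

Lemma normc_one_sub_arc_cplx t : Normc.normc (1 - arc_cplx t) <= 1.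
Proof.
rewrite -[leRHS]sqrtr1 /= ler_wsqrtr// sub0r sqrrN ltW//.
exact: arc_norm_lt1.
Qed.

Lemma normc_cis_sub1 t : Normc.normc ((cos t -i* sin t)%C - 1) <= `|t|.
Proof.
rewrite /= oppr0 addr0 sqrrN -sqrtr_sqr ler_wsqrtr//.
have := one_sub_cos_le _ t; have := cos2Dsin2 t; rewrite sqrrB; lra.
Qed.

(** Chords are shorter than arcs: moving along the circle by [t] changes the distance to [z] by at
    most [|t|]. *)
Lemma arc_dist_le phi t : arc_dist phi <= arc_dist (phi + t) + `|t|.
Proof.
rewrite -!normc_arc_cplx.
have -> : arc_cplx phi = arc_cplx (phi + t)
    + (1 - arc_cplx phi) * ((cos t -i* sin t)%C - 1).
  by rewrite arc_cplxD; ring.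
apply: (le_trans (le_normcD _ _)); rewrite lerD2l Normc.normcM.
rewrite -[leRHS]mul1r; apply: ler_pM; rewrite ?normc_ge0//.
- exact: normc_one_sub_arc_cplx.
- exact: normc_cis_sub1.
Qed.

(** The closed form shows both sizes at once: [1 - cos t] is quadratic in [t], and the denominator
    gives the inverse cube of the distance. *)
Lemma arc_second_difference phi t : 
  (arc_cplx (phi + t))^-1 + (arc_cplx (phi - t))^-1 - 2 * (arc_cplx phi)^-1 =
  - (2 * (1 - cos t))%:C%C * (1 - arc_cplx phi) * (2 - arc_cplx phi)
    / (arc_cplx (phi + t) * arc_cplx (phi - t) * arc_cplx phi).
Proof.
have := arc_cplx_neq0 (phi + t); have := arc_cplx_neq0 (phi - t).
have := arc_cplx_neq0 phi.
have e : (cos t -i* sin t)%C * (cos t +i* sin t)%C = 1 :> R[i].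
  apply/eqP; rewrite eq_complex /= -!expr2 mulNr opprK -!expr2 cos2Dsin2 eqxx/=.
  by apply/eqP; ring.
have e2 : (2 * (1 - cos t))%:C%C =
    2 - (cos t -i* sin t)%C - (cos t +i* sin t)%C :> R[i].
  by apply/eqP; rewrite eq_complex /=; apply/andP; split; apply/eqP; ring.
rewrite !arc_cplxD cosN sinN opprK e2.
move: (cos t -i* sin t)%C (cos t +i* sin t)%C (arc_cplx phi) e => c d v cd v0.
set p := 1 - _ * c; set q := 1 - _ * d; move=> h1 h2.
transitivity (((p + q) * v - 2 * p * q) / (p * q * v)).
  by field; apply/and3P.
congr (_ / _).
(* As polynomials the two numerators differ by a multiple of [c * d - 1], which is 0 for the
   conjugate phases [c] and [d]. *)
transitivity (- (2 - c - d) * (1 - v) * (2 - v) - 2 * (1 - v) ^+ 2 * (c * d - 1)).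
  by rewrite /p /q; ring.
by rewrite cd subrr mulr0 subr0.
Qed.

(** For such [t] both neighbours stay at distance at least [arc_dist phi / 2], so the denominator is
    at least [arc_dist phi ^+ 3 / 4]; the numerator is at most [2 t^2]. *)
Lemma normc_arc_second_difference phi t : `|t| <= arc_dist phi / 2 ->
  Normc.normc ((arc_cplx (phi + t))^-1 + (arc_cplx (phi - t))^-1
    - 2 * (arc_cplx phi)^-1) <= 8 * t ^+ 2 / arc_dist phi ^+ 3.
Proof.
move=> tr; rewrite arc_second_difference !(Normc.normcM, Normc.normcV, normcN).
rewrite !normc_arc_cplx.
have r0 := arc_dist_gt0 phi.
have hp : arc_dist phi / 2 <= arc_dist (phi + t).
  by have := arc_dist_le phi t; lra.
have hm : arc_dist phi / 2 <= arc_dist (phi - t).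
  by have := arc_dist_le phi (- t); rewrite normrN; lra.
have h2 : Normc.normc (2 - arc_cplx phi) <= 2.
  have -> : 2 - arc_cplx phi = 1 + (1 - arc_cplx phi) by ring.
  apply: (le_trans (le_normcD _ _)); rewrite Normc.normc1.
  by have := normc_one_sub_arc_cplx phi; lra.
have hc : Normc.normc (2 * (1 - cos t))%:C%C <= t ^+ 2.
  rewrite /= expr0n addr0 sqrtr_sqr ger0_norm ?mulr_ge0 ?subr_ge0 ?cos_le1//.
  by have := one_sub_cos_le _ t; lra.
have num : Normc.normc (2 * (1 - cos t))%:C%C * Normc.normc (1 - arc_cplx phi)
    * Normc.normc (2 - arc_cplx phi) <= 2 * t ^+ 2.
  rewrite [leRHS]mulrC; apply: ler_pM; rewrite ?mulr_ge0 ?normc_ge0//.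
  rewrite -[leRHS]mulr1; apply: ler_pM; rewrite ?normc_ge0//.
  exact: normc_one_sub_arc_cplx.
have den : arc_dist phi ^+ 3 / 4 <=
    arc_dist (phi + t) * arc_dist (phi - t) * arc_dist phi.
  have -> : arc_dist phi ^+ 3 / 4 = arc_dist phi / 2 * (arc_dist phi / 2) * arc_dist phi.
    by field.
  rewrite ler_pM2r//; have h0 : 0 <= arc_dist phi / 2 by rewrite divr_ge0// ltW.
  exact: ler_pM.
have d0 : 0 < arc_dist phi ^+ 3 / 4 by rewrite divr_gt0 ?exprn_gt0.
rewrite (_ : 8 * t ^+ 2 / _ = 2 * t ^+ 2 * (arc_dist phi ^+ 3 / 4)^-1); last first.
  by field; rewrite gt_eqF.
apply: ler_pM => //.
- by rewrite !mulr_ge0 ?normc_ge0.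
- by rewrite invr_ge0 !mulr_ge0 ?(ltW (arc_dist_gt0 _)).
- by rewrite lef_pV2 ?posrE ?(lt_le_trans d0).
Qed.

(** With [w = arc_cplx t], [darc_ln] is [- Im (1/w)] and [darc_arg] is [Re (1/w) - 1]; the constant
    cancels in second differences. *)
Definition darc_ln t := arc_im t / arc_sq t.
Definition darc_arg t := arc_re t / arc_sq t - 1.

Lemma darc_ln_second_difference phi t : `|t| <= arc_dist phi / 2 ->
  `|darc_ln (phi + t) + darc_ln (phi - t) - 2 * darc_ln phi|
    <= 8 * t ^+ 2 / arc_dist phi ^+ 3.
Proof.
move=> /normc_arc_second_difference; apply: le_trans.
apply: le_trans (normr_Im_le _ _); rewrite -normrN.
by rewrite le_eqVlt; apply/orP; left; apply/eqP; congr `|_|;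
  rewrite mulr_natl mulr2n /= /darc_ln /arc_sq; ring.
Qed.

Lemma darc_arg_second_difference phi t : `|t| <= arc_dist phi / 2 ->
  `|darc_arg (phi + t) + darc_arg (phi - t) - 2 * darc_arg phi|
    <= 8 * t ^+ 2 / arc_dist phi ^+ 3.
Proof.
move=> /normc_arc_second_difference; apply: le_trans.
apply: le_trans (normr_Re_le _ _).
by rewrite le_eqVlt; apply/orP; left; apply/eqP; congr `|_|;
  rewrite mulr_natl mulr2n /= /darc_arg /arc_sq; ring.
Qed.

(** * Midpoint errors bounded by the kernel *)

Definition arc_kernel l t := l ^+ 2 / (arc_dist t * (arc_dist t ^+ 2 + l ^+ 2)).

Lemma arc_kernelE l t :
  planar_kernel R l ((x, y) - (cos t, sin t)) = arc_kernel l t.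
Proof.
by rewrite /arc_kernel /planar_kernel /= /arc_dist sqr_sqrtr ?(ltW (arc_sq_gt0 t))// arc_sqE.
Qed.

Lemma arc_kernel_ge0 l t : 0 <= arc_kernel l t.
Proof. by rewrite -arc_kernelE planar_kernel_ge0. Qed.

(** In the near regime [dist^2 + l^2 <= (c^2 + 1) l^2], so the kernel is comparable to the inverse
    distance. *)
Lemma inv_le_arc_kernel (c l : R) t : 0 < l -> arc_dist t <= c * l ->
  (arc_dist t)^-1 <= (c ^+ 2 + 1) * arc_kernel l t.
Proof.
move=> l0 rl; have r0 := arc_dist_gt0 t.
have s0 : 0 < arc_dist t ^+ 2 + l ^+ 2 by rewrite addr_gt0 ?exprn_gt0.
have -> : (c ^+ 2 + 1) * arc_kernel l t =
    (c ^+ 2 + 1) * l ^+ 2 / (arc_dist t ^+ 2 + l ^+ 2) / arc_dist t.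
  by rewrite /arc_kernel; field; rewrite !gt_eqF.
rewrite -[leLHS]mul1r ler_pM2r ?invr_gt0// ler_pdivlMr// mul1r mulrDl mul1r.
rewrite -exprMn lerD2r lerXn2r ?nnegrE// ?(ltW r0)//.
exact: le_trans (ltW r0) rl.
Qed.

Lemma arc_midpoint_far (f df : R -> R) l phi : 0 < l -> l <= arc_dist phi ->
  (forall t, is_derive t 1 f (df t)) ->
  (forall t, `|t| <= arc_dist phi / 2 ->
    `|df (phi + t) + df (phi - t) - 2 * df phi| <= 8 * t ^+ 2 / arc_dist phi ^+ 3) ->
  `|l * df phi - (f (phi + l / 2) - f (phi - l / 2))| <= 2 * l * arc_kernel l phi.
Proof.
move=> l0 lr fdf second; have r0 := arc_dist_gt0 phi.
have r30 : 0 < arc_dist phi ^+ 3 by rewrite exprn_gt0.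
have := @midpoint_rule_le _ f df phi (l / 2) (8 * (l / 2) ^+ 2 / arc_dist phi ^+ 3) _ fdf.
rewrite (_ : 2 * (l / 2) = l); last by field.
move=> H; apply: (le_trans (H _ _)).
- by rewrite divr_ge0// ltW.
- move=> t /andP[t0 tl]; apply: (le_trans (second _ _)).
    by rewrite ger0_norm// (le_trans tl)// ler_pM2r.
  by rewrite ler_pM2r ?invr_gt0// ler_pM2l// lerXn2r ?nnegrE// (le_trans t0).
- have s0 : 0 < arc_dist phi ^+ 2 + l ^+ 2 by rewrite addr_gt0 ?exprn_gt0.
  (* The midpoint rule gives [l^3 / dist^3]; since [l <= dist], replacing [dist^2] by [dist^2 + l^2]
     costs at most a factor 2. *)
  rewrite (_ : _ * (l / 2) = l ^+ 3 / arc_dist phi ^+ 3); last first.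
    by field; rewrite gt_eqF.
  rewrite (_ : 2 * l * _ = l ^+ 3 / arc_dist phi ^+ 3 *
      (2 * arc_dist phi ^+ 2 / (arc_dist phi ^+ 2 + l ^+ 2))); last first.
    by rewrite /arc_kernel; field; rewrite !gt_eqF.
  rewrite ler_peMr ?divr_ge0 ?exprn_ge0 ?(ltW l0) ?(ltW r0)//.
  rewrite ler_pdivlMr// mul1r.
  have : l ^+ 2 <= arc_dist phi ^+ 2 by rewrite lerXn2r ?nnegrE ?(ltW l0) ?(ltW r0).
  by lra.
Qed.

Lemma normr_darc_ln_le t : `|darc_ln t| <= (arc_dist t)^-1.
Proof.
have r0 := arc_dist_gt0 t.
have e : arc_sq t = arc_dist t ^+ 2 by rewrite sqr_sqrtr// ltW// arc_sq_gt0.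
rewrite /darc_ln normrM normfV (gtr0_norm (arc_sq_gt0 t)) e expr2 invfM mulrA.
rewrite ler_piMl ?invr_ge0 ?(ltW r0)// ler_pdivrMr// mul1r.
by rewrite /arc_dist -sqrtr_sqr ler_wsqrtr// /arc_sq lerDr sqr_ge0.
Qed.

(** Subtracting 1 is harmless: [|1/w - 1| = |1 - w| / |w|] and [|1 - w| < 1], used here as
    [arc_sq < 2 * arc_re]. *)
Lemma normr_darc_arg_le t : `|darc_arg t| <= (arc_dist t)^-1.
Proof.
have r0 := arc_dist_gt0 t; have s0 := arc_sq_gt0 t.
rewrite /arc_dist -sqrtrV ?(ltW s0)// -sqrtr_sqr ler_wsqrtr//.
rewrite -[leRHS]mul1r ler_pdivlMr//.
have -> : darc_arg t ^+ 2 * arc_sq t =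
    (arc_re t ^+ 2 - 2 * arc_re t * arc_sq t + arc_sq t ^+ 2) / arc_sq t.
  by rewrite /darc_arg; field; rewrite gt_eqF.
rewrite ler_pdivrMr// mul1r.
have := arc_sq_lt t; have : arc_re t ^+ 2 <= arc_sq t by rewrite lerDl sqr_ge0.
move=> h1 h2.
have : 0 <= arc_sq t * (2 * arc_re t - arc_sq t).
  by rewrite mulr_ge0 ?subr_ge0 ?ltW.
by lra.
Qed.

Lemma arc_arg_midpoint l phi : 0 < l ->
  `|l * darc_arg phi - (arc_arg (phi + l / 2) - arc_arg (phi - l / 2))|
    <= 10 * l * arc_kernel l phi.
Proof.
move=> l0; have k0 := arc_kernel_ge0 l phi.
have lk0 : 0 <= l * arc_kernel l phi by rewrite mulr_ge0// ltW.
have [lr|rl] := leP l (arc_dist phi).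
  apply: (le_trans (arc_midpoint_far _ _ _ _ l0 lr is_derive_arc_arg _)).
    by move=> t; exact: darc_arg_second_difference.
  by lra.
have r0 := arc_dist_gt0 phi.
have ir : (arc_dist phi)^-1 <= 2 * arc_kernel l phi.
  have := @inv_le_arc_kernel 1 l phi l0; rewrite mul1r expr1n.
  by apply; exact: ltW.
(* Near the arc the arctangents differ by at most [pi <= 4], and [1 <= l / dist <= 2 l K] with [K]
   the kernel: in total [(1 + 4) * 2 = 10]. *)
have lir : 1 <= l * (arc_dist phi)^-1 by rewrite ler_pdivlMr// mul1r ltW.
have lir2 : l * (arc_dist phi)^-1 <= l * (2 * arc_kernel l phi) by rewrite ler_pM2l.
apply: (le_trans (ler_normB _ _)).
have h1 : `|l * darc_arg phi| <= l * (arc_dist phi)^-1.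
  by rewrite normrM (gtr0_norm l0) ler_pM2l// normr_darc_arg_le.
have h2 : `|arc_arg (phi + l / 2) - arc_arg (phi - l / 2)| <= 4.
  have := pihalf_lt2 R; rewrite /arc_arg ler_norml.
  have := atan_ltpi2 (arc_im (phi + l / 2) / arc_re (phi + l / 2)).
  have := atan_gtNpi2 (arc_im (phi + l / 2) / arc_re (phi + l / 2)).
  have := atan_ltpi2 (arc_im (phi - l / 2) / arc_re (phi - l / 2)).
  have := atan_gtNpi2 (arc_im (phi - l / 2) / arc_re (phi - l / 2)).
  move: (atan _) (atan _) (pi / 2) => a1 a2 p *; apply/andP; split; lra.
by lra.
Qed.

(* From [ln u <= u], applied to the ratio of the two distances. *)
Lemma arc_ln_sub_le l s t : 0 < l -> arc_dist s <= 2 * l -> arc_dist t <= 2 * l ->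
  arc_ln s - arc_ln t <= 10 * l * arc_kernel l t.
Proof.
move=> l0 sl tl; have s0 := arc_dist_gt0 s; have t0 := arc_dist_gt0 t.
have lnE u : arc_ln u = ln (arc_dist u).
  rewrite /arc_ln -(sqr_sqrtr (ltW (arc_sq_gt0 u))) lnXn ?arc_dist_gt0//.
  by rewrite mulr2n /arc_dist; field.
rewrite !lnE -ln_div ?posrE//.
apply: (le_trans (ltW (ln_sublinear (divr_gt0 s0 t0)))).
have := inv_le_arc_kernel 2 l t l0 tl => ht.
apply: (@le_trans _ _ (2 * l * (arc_dist t)^-1));
  first by rewrite ler_pM2r ?invr_gt0.
by have := ler_wpM2l (ltW l0) ht; lra.
Qed.

(** Unlike the argument, the logarithm is unbounded when [z] approaches an endpoint of the arc,
    hence the kernels centred at both endpoints. *)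
Lemma arc_ln_midpoint l phi : 0 < l ->
  `|l * darc_ln phi - (arc_ln (phi + l / 2) - arc_ln (phi - l / 2))|
    <= 10 * l * (arc_kernel l phi + arc_kernel l (phi + l / 2)
                 + arc_kernel l (phi - l / 2)).
Proof.
move=> l0.
have lk0 t : 0 <= l * arc_kernel l t by rewrite mulr_ge0 ?arc_kernel_ge0// ltW.
have k0 := lk0 phi; have k1 := lk0 (phi + l / 2); have k2 := lk0 (phi - l / 2).
have [lr|rl] := leP l (arc_dist phi).
  apply: (le_trans (arc_midpoint_far _ _ _ _ l0 lr is_derive_arc_ln _)).
    by move=> t; exact: darc_ln_second_difference.
  by lra.
have r0 := arc_dist_gt0 phi.
have ir : (arc_dist phi)^-1 <= 2 * arc_kernel l phi.
  have := @inv_le_arc_kernel 1 l phi l0; rewrite mul1r expr1n.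
  by apply; exact: ltW.
have lir2 : l * (arc_dist phi)^-1 <= l * (2 * arc_kernel l phi) by rewrite ler_pM2l.
have h1 : `|l * darc_ln phi| <= l * (arc_dist phi)^-1.
  by rewrite normrM (gtr0_norm l0) ler_pM2l// normr_darc_ln_le.
have dp : arc_dist (phi + l / 2) <= 2 * l.
  have := arc_dist_le (phi + l / 2) (- (l / 2)).
  rewrite addrK normrN ger0_norm ?divr_ge0 ?(ltW l0)//.
  by lra.
have dm : arc_dist (phi - l / 2) <= 2 * l.
  have := arc_dist_le (phi - l / 2) (l / 2).
  rewrite subrK ger0_norm ?divr_ge0 ?(ltW l0)//.
  by lra.
apply: (le_trans (ler_normB _ _)).
have h2 : `|arc_ln (phi + l / 2) - arc_ln (phi - l / 2)|
   <= 10 * l * (arc_kernel l (phi + l / 2) + arc_kernel l (phi - l / 2)).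
  have := arc_ln_sub_le l _ _ l0 dp dm; have := arc_ln_sub_le l _ _ l0 dm dp.
  by rewrite ler_norml => *; apply/andP; split; lra.
by lra.
Qed.

End arc_functions.

(** * Domination of the Cauchy sum *)

Section planar_integral_bounds.
Variable R : realType.
Implicit Types (f g : R * R -> R) (a b c : R).

(** Bundling measurability and nonnegativity with the bound lets bounds be added and scaled without
    repeating side conditions. *)
Definition planar_int_le f a := [/\ measurable_fun [set: R * R] f,
  (forall p, 0 <= f p) & (\int[@planar_lebesgue R]_p (f p)%:E <= a%:E)%E].

Lemma planar_int_leD f g a b : planar_int_le f a -> planar_int_le g b ->
  planar_int_le (fun p => f p + g p) (a + b).
Proof.
move=> [mf f0 fa] [mg g0 gb]; split; first exact: measurable_funD.
  by move=> p; rewrite addr_ge0.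
under eq_integral do rewrite EFinD.
rewrite ge0_integralD//; first by rewrite EFinD; apply: leeD.
- by move=> p _; rewrite lee_fin.
- exact/measurable_EFinP.
- by move=> p _; rewrite lee_fin.
- exact/measurable_EFinP.
Qed.

Lemma planar_int_leZ f a c : 0 <= c -> planar_int_le f a ->
  planar_int_le (fun p => c * f p) (c * a).
Proof.
move=> c0 [mf f0 fa]; split; first exact: measurable_funM.
  by move=> p; rewrite mulr_ge0.
under eq_integral do rewrite EFinM.
rewrite ge0_integralZl//; first by rewrite EFinM lee_wpmul2l ?lee_fin.
- exact/measurable_EFinP.
- by move=> p _; rewrite lee_fin.
Qed.

Lemma planar_int_le_sum n (f : 'I_n -> R * R -> R) (a : 'I_n -> R) :
  (forall k, planar_int_le (f k) (a k)) ->
  planar_int_le (fun p => \sum_(k < n) f k p) (\sum_(k < n) a k).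
Proof.
move=> fa; elim: n f a fa => [|n IH] f a fa.
  under [X in planar_int_le X _]eq_fun do rewrite big_ord0.
  rewrite big_ord0; split => //.
  by rewrite integral0.
under [X in planar_int_le X _]eq_fun do rewrite big_ord_recl.
rewrite big_ord_recl; apply: planar_int_leD => //.
by apply: (IH (fun k => f (lift ord0 k))).
Qed.

Lemma planar_int_le_kernel l (a : R * R) : 0 < l ->
  planar_int_le (fun p => planar_kernel R l (p - a)) (8 * pi ^+ 2 * l).
Proof.
move=> l0; split; first exact: measurable_planar_kernel.
  by move=> p; exact: planar_kernel_ge0.
exact: integral_planar_kernel.
Qed.

Lemma measurable_unit_disc : measurable (@unit_disc R).
Proof.
have m : measurable_fun [set: R * R] (fun p : R * R => p.1 ^+ 2 + p.2 ^+ 2).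
  by apply: measurable_funD; apply: measurable_funX.
have := m measurableT _ (measurable_itv `]-oo, (1 : R)[%R).
by rewrite setTI; congr measurable.
Qed.

Lemma measurable_normc_sum n (alpha : 'I_n -> R) (z : 'I_n -> R[i]) :
  measurable_fun [set: R * R] (fun p =>
    Normc.normc (\sum_(k < n) ((alpha k)%:C)%C / (cplx p - z k))).
Proof.
have mx k : measurable_fun [set: R * R] (fun p : R * R => p.1 - complex.Re (z k)).
  exact: measurable_funB.
have my k : measurable_fun [set: R * R] (fun p : R * R => p.2 - complex.Im (z k)).
  exact: measurable_funB.
have mn k : measurable_fun [set: R * R] (fun p : R * R =>
    ((p.1 - complex.Re (z k)) ^+ 2 + (p.2 - complex.Im (z k)) ^+ 2)^-1).
  by apply: measurable_funV; apply: measurable_funD; apply: measurable_funX.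
rewrite (_ : (fun p => _) = (fun p : R * R => Num.sqrt (
   (\sum_(k < n) alpha k * ((p.1 - complex.Re (z k)) *
     ((p.1 - complex.Re (z k)) ^+ 2 + (p.2 - complex.Im (z k)) ^+ 2)^-1)) ^+ 2
   + (\sum_(k < n) - (alpha k * ((p.2 - complex.Im (z k)) *
     ((p.1 - complex.Re (z k)) ^+ 2 + (p.2 - complex.Im (z k)) ^+ 2)^-1))) ^+ 2))).
  apply: measurable_fun_sqrt; apply: measurable_funD; apply: measurable_funX;
    apply: measurable_sum => k.
  - by apply: measurable_funM => //; exact: measurable_funM.
  - apply: measurableT_comp => //.
    by apply: measurable_funM => //; exact: measurable_funM.
apply/funext => p; rewrite normc_Re_Im Re_sum Im_sum.
congr (Num.sqrt (_ ^+ 2 + _ ^+ 2)); apply: eq_bigr => k _;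
  case: (z k) => a b; case: p => x y; rewrite /cplx /=; ring.
Qed.

(** The origin, a null point, is exempt because the pointwise bound arises from division by
    [|z|]. *)
Lemma integral_unit_disc_le f g a : measurable_fun [set: R * R] f ->
  (forall p, 0 <= f p) -> planar_int_le g a ->
  (forall p, unit_disc p -> p != 0 -> f p <= g p) ->
  (\int[@planar_lebesgue R]_(p in @unit_disc R) (f p)%:E <= a%:E)%E.
Proof.
move=> mf f0 [mg g0 ga] fg; apply: le_trans ga.
have mD := measurable_unit_disc.
apply: (@le_trans _ _ (\int[@planar_lebesgue R]_(p in @unit_disc R) (g p)%:E)%E).
  apply: ae_ge0_le_integral => //.
  - by move=> p _; rewrite lee_fin.
  - by apply: measurable_funTS; exact/measurable_EFinP.
  - by move=> p _; rewrite lee_fin.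
  - by apply: measurable_funTS; exact/measurable_EFinP.
  exists ([set 0] `*` [set 0]); split.
  - exact: measurableX.
  - rewrite [LHS]product_measure1E//.
    by rewrite [X in (X * _)%E](lebesgue_measure_set1 0) mul0e.
  - move=> p /= /not_implyP[Dp H].
    have [->//|p0] := eqVneq p 0.
    by exfalso; apply: H; rewrite lee_fin fg.
apply: ge0_subset_integral => //.
- exact/measurable_EFinP.
- by move=> p _; rewrite lee_fin.
Qed.

End planar_integral_bounds.

(** * Pointwise bound for the Cauchy sum in the disc *)

Section pointwise_bound.
Variable R : realType.

Definition circle_point (t : R) : R * R := (cos t, sin t).

Lemma on_unit_circle_cis (t : R) : on_unit_circle (cplx (circle_point t)).
Proof. by rewrite /on_unit_circle /cplx /= cos2Dsin2 sqrtr1. Qed.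

(** With [w = 1 - z e^(-it)], the quotient is [1 - 1/w = i (log w)']. Multiplying the Cauchy sum by
    [z] thus expresses it through the derivatives handled by the midpoint rule. *)
Lemma cplx_div_circle_sub (p : R * R) (t : R) : unit_disc p ->
  cplx p / (cplx p - cplx (circle_point t)) =
  (- darc_arg R p.1 p.2 t +i* darc_ln R p.1 p.2 t)%C.
Proof.
case: p => x y p1; rewrite /unit_disc/= in p1.
have v0 := arc_cplx_neq0 R x y p1 t.
have e1 : (cos t +i* sin t)%C * (cos t -i* sin t)%C = 1 :> R[i].
  apply/eqP; rewrite eq_complex /= mulrN opprK -!expr2 cos2Dsin2 eqxx/=.
  by apply/eqP; ring.
have e0 : (cos t +i* sin t)%C != 0 :> R[i].
  by apply/eqP => c0; move/eqP: e1; rewrite c0 mul0r eq_sym oner_eq0.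
have vE : arc_cplx R x y t = 1 - (x +i* y)%C * (cos t -i* sin t)%C.
  apply/eqP; rewrite eq_complex /= /arc_re /arc_im.
  by apply/andP; split; apply/eqP; ring.
have zE : (x +i* y)%C - (cos t +i* sin t)%C = - (cos t +i* sin t)%C * arc_cplx R x y t.
  rewrite vE mulrBr mulr1 mulrCA mulNr e1; ring.
have -> : (- darc_arg R x y t +i* darc_ln R x y t)%C = 1 - (arc_cplx R x y t)^-1.
  apply/eqP; rewrite eq_complex /= /darc_arg /darc_ln /arc_sq.
  by apply/andP; split; apply/eqP; ring.
rewrite /cplx /= zE.
have -> : (x +i* y)%C = (cos t +i* sin t)%C * (1 - arc_cplx R x y t).
  by apply/eqP; rewrite -subr_eq0 mulrBr mulr1 opprB addrCA zE mulNr subrr.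
by field; rewrite e0 v0.
Qed.

(* For [|z| < 1/2] the kernel is at most [8 l^2], and [1 / |z|] is itself
   dominated by the kernel of scale [1] centred at the origin. *)
Lemma kernel_div_norm_le (p : R * R) (l t : R) : unit_disc p -> p != 0 ->
  planar_kernel R l (p - circle_point t) / Normc.normc (cplx p)
  <= 2 * planar_kernel R l (p - circle_point t)
     + 16 * l ^+ 2 * planar_kernel R 1 (p - 0).
Proof.
case: p => x y; rewrite /unit_disc/= => p1 p0.
have k0 := planar_kernel_ge0 R l ((x, y) - circle_point t).
have k1 := planar_kernel_ge0 R 1 ((x, y) - 0).
set r := Num.sqrt _.
have s0 : 0 < x ^+ 2 + y ^+ 2.
  rewrite lt_def addr_ge0 ?sqr_ge0// andbT paddr_eq0 ?sqr_ge0// !sqrf_eq0.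
  by apply: contra p0 => /andP[/eqP-> /eqP->].
have r0 : 0 < r by rewrite sqrtr_gt0.
have rr : r ^+ 2 = x ^+ 2 + y ^+ 2 by rewrite sqr_sqrtr// ltW.
have r1 : r < 1 by rewrite -(ltr_pXn2r (n := 2)) ?nnegrE ?(ltW r0)// rr expr1n.
have [r2|r2] := leP 2^-1 r.
  have : planar_kernel R l ((x, y) - circle_point t) / r <=
      planar_kernel R l ((x, y) - circle_point t) * 2.
    by rewrite ler_wpM2l// -[leRHS]invrK lef_pV2 ?posrE ?invr_gt0.
  have : 0 <= 16 * l ^+ 2 * planar_kernel R 1 ((x, y) - 0).
    by rewrite mulr_ge0// mulr_ge0// sqr_ge0.
  by lra.
have kr : r^-1 <= 2 * planar_kernel R 1 ((x, y) - 0).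
  rewrite /planar_kernel /= !subr0 -/r -rr expr1n.
  have q0 : 0 < r ^+ 2 + 1 by rewrite ltr_wpDl ?sqr_ge0.
  rewrite (_ : 2 * _ = r^-1 * (2 / (r ^+ 2 + 1))); last first.
    by field; rewrite !gt_eqF.
  rewrite ler_peMr ?invr_ge0 ?(ltW r0)// ler_pdivlMr// mul1r.
  have : r ^+ 2 <= 1 by rewrite rr ltW.
  by lra.
have d2 : 2^-1 <= arc_dist R x y t.
  apply: (@le_trans _ _ (arc_re R x y t)).
    have := arc_normE R x y t; have := sqr_ge0 (arc_im R x y t); rewrite -rr.
    by move: (arc_re _ _ _ _) (arc_im _ _ _ _) => a b *; nra.
  rewrite /arc_dist -[leLHS]ger0_norm ?(ltW (arc_re_gt0 _ _ _ p1 t))//.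
  by rewrite -sqrtr_sqr ler_wsqrtr// lerDl sqr_ge0.
have kl : planar_kernel R l ((x, y) - circle_point t) <= 8 * l ^+ 2.
  rewrite arc_kernelE// /arc_kernel mulrC ler_wpM2r ?sqr_ge0//.
  have d0 := arc_dist_gt0 R x y p1 t.
  have q0 : 0 < arc_dist R x y t ^+ 2 + l ^+ 2.
    by rewrite ltr_pwDl ?sqr_ge0// exprn_gt0.
  rewrite -[8]invrK lef_pV2 ?posrE ?mulr_gt0 ?invr_gt0//.
  have -> : 8^-1 = 2^-1 * 4^-1 :> R by field.
  apply: ler_pM => //; have := sqr_ge0 l => l2.
  have : 2^-1 ^+ 2 <= arc_dist R x y t ^+ 2 by rewrite lerXn2r ?nnegrE ?(ltW d0).
  by lra.
have : planar_kernel R l ((x, y) - circle_point t) / r <=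
    8 * l ^+ 2 * (2 * planar_kernel R 1 ((x, y) - 0)).
  by apply: ler_pM; rewrite ?invr_ge0 ?(ltW r0).
by lra.
Qed.

Section arcs.
Variables (n : nat) (alpha l B : 'I_n -> R) (theta : nat -> R) (c : R).
Hypothesis c_gt0 : 0 < c.
Hypothesis l_gt0 : forall k, 0 < l k.
Hypothesis alphaE : forall k, alpha k = c * l k.
Hypothesis thetaS : forall k : 'I_n, theta k.+1 = theta k + l k.
Let phi (k : 'I_n) := theta k + l k / 2.

Let phiD k : phi k + l k / 2 = theta k.+1.
Proof. by rewrite thetaS /phi; field. Qed.

Let phiB k : phi k - l k / 2 = theta k.
Proof. by rewrite /phi addrK. Qed.

(* Subtracting the telescoping sum, which vanishes, turns the weighted sum into
   a sum of midpoint-rule errors. *)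
Lemma normr_weighted_sum_le (f df : R -> R) : f (theta n) = f (theta 0) ->
  (forall k, `|l k * df (phi k) - (f (phi k + l k / 2) - f (phi k - l k / 2))|
     <= 10 * l k * B k) ->
  `|\sum_(k < n) alpha k * df (phi k)| <= \sum_(k < n) 10 * alpha k * B k.
Proof.
move=> fper err.
have tel : \sum_(k < n) (f (theta k.+1) - f (theta k)) = 0.
  rewrite -(big_mkord xpredT (fun k => f (theta k.+1) - f (theta k))).
  by rewrite telescope_sumr// fper subrr.
have -> : \sum_(k < n) alpha k * df (phi k) = \sum_(k < n)
    c * (l k * df (phi k) - (f (phi k + l k / 2) - f (phi k - l k / 2))).
  rewrite -mulr_sumr; under [in RHS]eq_bigr do rewrite phiD phiB.
  rewrite sumrB tel subr0 mulr_sumr; apply: eq_bigr => k _.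
  by rewrite alphaE mulrA.
apply: (le_trans (ler_norm_sum _ _ _)); apply: ler_sum => k _.
rewrite normrM (gtr0_norm c_gt0) alphaE.
rewrite (_ : 10 * _ * _ = c * (10 * l k * B k)); last by ring.
by rewrite ler_pM2l.
Qed.

End arcs.

Lemma normc_cauchy_sum_le n (alpha l : 'I_n -> R) (theta : nat -> R) (c : R)
    (phi := fun k : 'I_n => theta k + l k / 2)
    (K := fun k p t => planar_kernel R (l k) (p - circle_point t)) p :
  0 < c -> (forall k, 0 < l k) -> (forall k, alpha k = c * l k) ->
  (forall k : 'I_n, theta k.+1 = theta k + l k) ->
  circle_point (theta n) = circle_point (theta 0) -> unit_disc p ->
  Normc.normc (cplx p) * Normc.normc (\sum_(k < n)
      ((alpha k)%:C)%C / (cplx p - cplx (circle_point (phi k))))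
  <= \sum_(k < n) 20 * alpha k *
       (K k p (phi k) + K k p (phi k + l k / 2) + K k p (phi k - l k / 2)).
Proof.
move=> c0 l0 alphaE thetaS [cper sper] Dp.
have p1 : p.1 ^+ 2 + p.2 ^+ 2 < 1 by exact: Dp.
rewrite -Normc.normcM mulr_sumr.
under eq_bigr => k _ do rewrite mulrCA cplx_div_circle_sub//.
apply: (le_trans (normc_le_ReIm _ _)); rewrite Re_sum Im_sum /=.
have KE k t : K k p t = arc_kernel R p.1 p.2 (l k) t.
  by rewrite /K -arc_kernelE//; case: (p).
set B := fun k => K k p (phi k) + K k p (phi k + l k / 2) + K k p (phi k - l k / 2).
have hA : `|\sum_(k < n) alpha k * darc_arg R p.1 p.2 (phi k)| <=
    \sum_(k < n) 10 * alpha k * B k.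
  apply: (@normr_weighted_sum_le n alpha l B theta c _ _ _ (arc_arg R p.1 p.2)) => //.
    by rewrite /arc_arg /arc_im /arc_re cper sper.
  move=> k; apply: (le_trans (arc_arg_midpoint _ _ _ p1 _ _ (l0 k))).
  (* The argument needs only the kernel at the midpoint; the endpoint kernels are added so that both
     parts share the bound [B]. *)
  rewrite ler_pM2l ?mulr_gt0// /B !KE.
  by rewrite -addrA lerDl addr_ge0// arc_kernel_ge0.
have hL : `|\sum_(k < n) alpha k * darc_ln R p.1 p.2 (phi k)| <=
    \sum_(k < n) 10 * alpha k * B k.
  apply: (@normr_weighted_sum_le n alpha l B theta c _ _ _ (arc_ln R p.1 p.2)) => //.
    by rewrite /arc_ln /arc_sq /arc_im /arc_re cper sper.
  move=> k; apply: (le_trans (arc_ln_midpoint _ _ _ p1 _ _ (l0 k))).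
  by rewrite /B !KE.
apply: (@le_trans _ _ (\sum_(k < n) 10 * alpha k * B k + \sum_(k < n) 10 * alpha k * B k)).
  apply: lerD.
    rewrite -normrN -sumrN; apply: le_trans hA; rewrite le_eqVlt; apply/orP; left.
    by apply/eqP; congr `|_|; apply: eq_bigr => k _; ring.
  apply: le_trans hL; rewrite le_eqVlt; apply/orP; left.
  by apply/eqP; congr `|_|; apply: eq_bigr => k _; ring.
by rewrite -big_split/=; apply: ler_sum => k _; rewrite /B; lra.
Qed.

End pointwise_bound.

(** * Choice of the arcs and final summation *)

Theorem theorem1p3 (R : realType) :
  exists C : R, 0 < C /\
  forall (n : nat) (alpha : 'I_n -> R),
    (forall k, 0 < alpha k) ->
    exists z : 'I_n -> R[i],
      (forall k, on_unit_circle (z k)) /\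
      (\int[@planar_lebesgue R]_(p in @unit_disc R)
          (Normc.normc (\sum_(k < n) ((alpha k)%:C)%C / (cplx p - z k)))%:E
       <= (C * ((\sum_(k < n) alpha k ^+ 2) / (\sum_(k < n) alpha k)))%:E)%E.
Proof.
have pi0 := pi_gt0 R.
(* Here [48 * 65 * pi^2 * l k] bounds [3 b k] once [l k <= 8], and
   [20 alpha_k l_k = 40 pi alpha_k^2 / A]. *)
exists (40 * 48 * 65 * pi ^+ 3); split; first by rewrite !mulr_gt0 ?exprn_gt0.
(* For [n = 0] the integrand vanishes and the right-hand side is [0 / 0 = 0]. *)
move=> n; have [->|n_gt0] := posnP n => alpha alpha_gt0.
  exists (fun=> cplx (circle_point R 0)); split=> [k|].
    exact: on_unit_circle_cis.
  rewrite !big_ord0 mul0r mulr0 integral0_eq// => p _.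
  by rewrite big_ord0 Normc.normc0.
set A := \sum_(k < n) alpha k.
have alpha_le k : alpha k <= A.
  by rewrite /A (bigD1 k)//= lerDl sumr_ge0// => i _; exact: ltW.
have A_gt0 : 0 < A by exact: lt_le_trans (alpha_gt0 (Ordinal n_gt0)) (alpha_le _).
(* Density of the mass [A] spread uniformly over the circle; an arc of length [l k] then carries
   mass [alpha k]. *)
pose c := A / (2 * pi).
have c_gt0 : 0 < c by rewrite divr_gt0// mulr_gt0.
pose l k := alpha k / c.
have l_gt0 k : 0 < l k by rewrite divr_gt0.
have alphaE k : alpha k = c * l k by rewrite /l mulrC divfK// gt_eqF.
pose theta m := \sum_(j < n | (j < m)%N) l j.
have thetaS (k : 'I_n) : theta k.+1 = theta k + l k.
  rewrite /theta (bigD1 k)//= addrC; congr (_ + _); apply: eq_bigl => j.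
  by rewrite [RHS]ltn_neqAle andbC -val_eqE.
have thetan : theta n = pi *+ 2.
  rewrite /theta (eq_bigl xpredT); last by move=> j; rewrite ltn_ord.
  by rewrite -mulr_suml -/A /c invf_div mulrCA divff ?gt_eqF// mulr1 mulr_natl.
have theta0 : theta 0%N = 0 by rewrite /theta big_pred0.
(* The arcs fill exactly one turn, so the telescoping sums over them vanish. *)
have closed : circle_point R (theta n) = circle_point R (theta 0%N).
  by rewrite thetan theta0 /circle_point cos2pi sin2pi cos0 sin0.
pose phi (k : 'I_n) := theta k + l k / 2.
exists (fun k => cplx (circle_point R (phi k))).
split; first by move=> k; exact: on_unit_circle_cis.
(* [G] dominates the kernel after division by [|z|], as in [kernel_div_norm_le]. *)
pose G k t p := 2 * planar_kernel R (l k) (p - circle_point R t)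
     + 16 * l k ^+ 2 * planar_kernel R 1 (p - 0).
pose g p := \sum_(k < n) 20 * alpha k *
  (G k (phi k) p + G k (phi k + l k / 2) p + G k (phi k - l k / 2) p).
pose b k := 2 * (8 * pi ^+ 2 * l k) + 16 * l k ^+ 2 * (8 * pi ^+ 2 * 1).
have Gb k t : planar_int_le R (G k t) (b k).
  apply: planar_int_leD; apply: planar_int_leZ.
  - by [].
  - exact: planar_int_le_kernel.
  - by rewrite mulr_ge0// sqr_ge0.
  - exact: planar_int_le_kernel.
have gb : planar_int_le R g (\sum_(k < n) 20 * alpha k * (b k + b k + b k)).
  apply: planar_int_le_sum => k; apply: planar_int_leZ.
    by rewrite mulr_ge0// ltW.
  by do 2!apply: planar_int_leD => //.
apply: (@le_trans _ _ (\sum_(k < n) 20 * alpha k * (b k + b k + b k))%:E).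
  apply: (integral_unit_disc_le R _ g) => //; first exact: measurable_normc_sum.
    by move=> p; exact: normc_ge0.
  move=> p Dp p0.
  have := normc_cauchy_sum_le R n alpha l theta c p c_gt0 l_gt0 alphaE thetaS closed Dp.
  have z0 : 0 < Normc.normc (cplx p).
    rewrite lt_def normc_ge0 andbT; apply: contra p0 => /eqP/Normc.eq0_normc.
    by case: (p) => x y [-> ->].
  rewrite mulrC -ler_pdivlMr// => H; apply: (le_trans H).
  rewrite mulr_suml; apply: ler_sum => k _.
  rewrite -[leLHS]mulrA ler_pM2l ?mulr_gt0//.
  have hk t := kernel_div_norm_le R p (l k) t Dp p0.
  by rewrite !mulrDl !lerD.
rewrite lee_fin mulr_suml mulr_sumr; apply: ler_sum => k _.
(* Each arc is at most the full circle, of length [2 pi < 8]; this makes the term of [b k] quadratic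
   in [l k] linear. *)
have lk8 : l k <= 8.
  rewrite /l ler_pdivrMr// /c; have := alpha_le k; have := pihalf_lt2 R => pi4.
  move=> aA; apply: (le_trans aA); rewrite mulrA ler_pdivlMr ?mulr_gt0//.
  by rewrite mulrC ler_pM2r//; lra.
have -> : 40 * 48 * 65 * pi ^+ 3 * (alpha k ^+ 2 / A) =
  20 * alpha k * (48 * 65 * pi ^+ 2 * l k).
  by rewrite /l /c invf_div; field; rewrite gt_eqF.
rewrite ler_pM2l ?mulr_gt0//.
have l2 : l k ^+ 2 <= 8 * l k by rewrite expr2 ler_pM2r.
have := ler_wpM2l (ltW (exprn_gt0 2 pi0)) l2.
by rewrite /b; lra.
Qed.
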